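(* Consider a Boolean control network (BCN) with $n$ state variables, $m$ inputs and $p$ outputs, with algebraic form $x(t+1)=Lu(t)x(t)$, $y(t)=Hx(t)$, where $L=[L_1,L_2,\dots,L_{2^m}]$, each $L_j\in\mathcal{L}_{2^n\times 2^n}$, and $H\in\mathcal{L}_{2^p\times 2^n}$. Let $0\le s\le n$. For each $j$ let $\mathcal{G}_j$ be the directed graph induced by $L_j$, and let $A=\{1,2,\dots,2^n\}$ be the common vertex set of $\{\mathcal{G}_j\}_{j=1}^{2^m}$. Color the vertices in $A$ in such a way that two vertices $\mu$ and $\lambda$ have the same color if and only if $H\delta_{2^n}^\mu=H\delta_{2^n}^\lambda$. Then the BCN is decomposable with respect to outputs with order $n-s$ if and only if $\{\mathcal{G}_j\}_{j=1}^{2^m}$ has a common concolorous perfect equal vertex partition (CC-PEVP) $\{S_l\}_{l=1}^{2^s}$ with $|S_l|=2^{n-s}$ for every $l$.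
   Context: Notation: $\delta_k^i$ is the $i$-th column of the identity matrix $I_k$, $\Delta_k=\{\delta_k^1,\dots,\delta_k^k\}$. A real $a\times b$ matrix is a logical matrix if every column lies in $\Delta_a$; $\mathcal{L}_{a\times b}$ is the set of all $a\times b$ logical matrices. BCN and algebraic form: let $\mathcal{D}=\{1,0\}$ (True, False). The BCN is $x_i(t+1)=f_i(x_1(t),\dots,x_n(t),u_1(t),\dots,u_m(t))$ $(1\le i\le n)$, $y_i(t)=h_i(x_1(t),\dots,x_n(t))$ $(1\le i\le p)$, with logical functions $f_i:\mathcal{D}^{n+m}\to\mathcal{D}$, $h_i:\mathcal{D}^n\to\mathcal{D}$. Identify True with $\delta_2^1$, False with $\delta_2^2$, and tuples with Kronecker products $x=x_1\otimes\cdots\otimes x_n\in\Delta_{2^n}$, $u=u_1\otimes\cdots\otimes u_m\in\Delta_{2^m}$, $y=y_1\otimes\cdots\otimes y_p\in\Delta_{2^p}$. Then $L,H$ are the unique logical matrices with $x(t+1)=L(u(t)\otimes x(t))$, written $Lu(t)x(t)$, and $y(t)=Hx(t)$; if $u(t)=\delta_{2^m}^j$ then $x(t+1)=L_jx(t)$. Decomposability: a logical coordinate transformation is a bijection $\mathcal{D}^n\to\mathcal{D}^n$, $(x_1,\dots,x_n)\mapsto(z_1,\dots,z_n)$. The BCN is decomposable with respect to outputs of (with) order $n-s$ if there is a logical coordinate transformation under which it takes the form $z_i(t+1)=\hat f_i(z_1(t),\dots,z_s(t),u_1(t),\dots,u_m(t))$ for $1\le i\le s$; $z_i(t+1)=\hat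 f_i(z_1(t),\dots,z_n(t),u_1(t),\dots,u_m(t))$ for $s+1\le i\le n$; $y_i(t)=\hat h_i(z_1(t),\dots,z_s(t))$ for $1\le i\le p$, with logical functions $\hat f_i,\hat h_i$. Graphs: the directed graph $\mathcal{G}_j$ induced by $L_j$ has vertex set $A=\{1,\dots,2^n\}$ and a directed edge $(q,k)$ if and only if $(L_j)_{kq}\neq 0$; then $k$ is an out-neighbor of $q$. $\mathcal{N}^j(S)$ denotes the set of all out-neighbors in $\mathcal{G}_j$ of vertices in $S\subset A$. Partitions: $\{S_l\}_{l=1}^{\mu}$ is a vertex partition of $A$ if $\bigcup_l S_l=A$ and $S_i\cap S_j=\emptyset$ for $i\ne j$; it is an equal vertex partition if moreover $|S_l|=|A|/\mu$ for all $l$. Given a coloring of $A$, an equal vertex partition $\{S_l\}_{l=1}^\mu$ is a CC-PEVP of $\{\mathcal{G}_j\}_{j=1}^{2^m}$ if (i) for all $l$ and $j$ there exists $\alpha_l^j$ such that $\mathcal{N}^j(S_l)\subset S_{\alpha_l^j}$; and (ii) for each $l$, all vertices in $S_l$ have the same color. *)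

(* Defs.v *)
From mathcomp Require Import all_boot all_order all_algebra.
From mathcomp Require Import reals.
From mathcomp Require Export mxtens.

Set Implicit Arguments.
Unset Strict Implicit.
Unset Printing Implicit Defensive.

Import GRing.Theory.
Local Open Scope ring_scope.

(* Indices are zero-based: the mathematical index i of 1, ..., k is the
   ordinal of value i - 1. *)

Section LogicalMatrices.
Variable R : realType.

Definition delta (k : nat) (i : 'I_k) : 'cV[R]_k := col i 1%:M.

Definition in_Delta (k : nat) (v : 'cV[R]_k) : Prop := exists i, v = delta i.

Definition logical_mx (a b : nat) (M : 'M[R]_(a, b)) : Prop :=
  forall j, in_Delta (col j M).

Definition bool_vec (b : bool) : 'cV[R]_2 :=
  if b then delta ord0 else delta ord_max.

(* v_1 (x) ... (x) v_k, with the empty product equal to the scalar 1; the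
   cast is along 2 * 2 ^ k = 2 ^ k.+1. *)
Fixpoint kron (k : nat) : ('I_k -> 'cV[R]_2) -> 'cV[R]_(2 ^ k) :=
  match k with
  | 0 => fun=> const_mx 1
  | k'.+1 => fun v =>
      castmx (esym (expnS 2 k'), muln1 1)
        (v ord0 *t kron (fun i : 'I_k' => v (lift ord0 i)))
  end.

End LogicalMatrices.

Notation boolvec k := {ffun 'I_k -> bool}.

Definition vec_of (R : realType) (k : nat) (x : boolvec k) : 'cV[R]_(2 ^ k) :=
  kron (fun i => bool_vec R (x i)).

Record bcn (n m p : nat) := BCN {
  bcn_f : 'I_n -> boolvec n -> boolvec m -> bool;
  bcn_h : 'I_p -> boolvec n -> bool
}.

Section BooleanControlNetworks.
Variables n m p : nat.
Implicit Type B : bcn n m p.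

Definition bcn_next B (x : boolvec n) (u : boolvec m) : boolvec n :=
  [ffun i => bcn_f B i x u].

Definition bcn_output B (x : boolvec n) : boolvec p := [ffun i => bcn_h B i x].

(* For logical matrices these equations determine L and H. *)
Definition algebraic_form (R : realType) B
    (L : 'M[R]_(2 ^ n, 2 ^ m * 2 ^ n)) (H : 'M[R]_(2 ^ p, 2 ^ n)) : Prop :=
  (forall x u, vec_of R (bcn_next B x u) = L *m (vec_of R u *t vec_of R x)) /\
  (forall x, vec_of R (bcn_output B x) = H *m vec_of R x).

(* The block L_j of L = [L_1, ..., L_(2 ^ m)]: mxtens_index (j, k) is the
   column j * 2 ^ n + k of L. *)
Definition input_block (R : realType) (L : 'M[R]_(2 ^ n, 2 ^ m * 2 ^ n))
    (j : 'I_(2 ^ m)) : 'M[R]_(2 ^ n) :=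
  colsub (fun k : 'I_(2 ^ n) => mxtens_index (j, k)) L.

Definition first_coords (s : nat) (hs : (s <= n)%N) (z : boolvec n) :
  boolvec s := [ffun i => z (widen_ord hs i)].

(* T is the coordinate transformation z = T x and r = n - s is the order. As
   the network may be started in any state, the equations in time t amount to
   equations at every state and every input. *)
Definition decomposable_wrt_outputs B (r : nat) : Prop :=
  exists (s : nat) (hs : (s <= n)%N), r = (n - s)%N /\
  exists (T : boolvec n -> boolvec n)
         (f1 : 'I_s -> boolvec s -> boolvec m -> bool)
         (f2 : 'I_n -> boolvec n -> boolvec m -> bool)
         (h1 : 'I_p -> boolvec s -> bool),
  [/\ bijective T,
      forall x u (i : 'I_s),
        T (bcn_next B x u) (widen_ord hs i) = f1 i (first_coords hs (T x)) u,
      forall x u (i : 'I_n), (s <= i)%N ->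
        T (bcn_next B x u) i = f2 i (T x) u
    & forall x (i : 'I_p), bcn_output B x i = h1 i (first_coords hs (T x))].

End BooleanControlNetworks.

Definition induced_graph (R : realType) (N : nat) (M : 'M[R]_N) : rel 'I_N :=
  fun q k => M k q != 0.

Section Partitions.
Variable V : finType.

Definition out_neighbors (G : rel V) (S : {set V}) : {set V} :=
  [set k | [exists q in S, G q k]].

Definition vertex_partition (mu : nat) (S : 'I_mu -> {set V}) : Prop :=
  \bigcup_l S l = [set: V] /\
  (forall i j, i != j -> S i :&: S j = set0).

Definition equal_vertex_partition (mu : nat) (S : 'I_mu -> {set V}) : Prop :=
  vertex_partition S /\ (forall l, #|S l|%:R = #|V|%:R / mu%:R :> rat).

Definition cc_pevp (J C : Type) (G : J -> rel V) (color : V -> C)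
    (mu : nat) (S : 'I_mu -> {set V}) : Prop :=
  [/\ equal_vertex_partition S,
      forall l j, exists alpha, out_neighbors (G j) (S l) \subset S alpha
    & forall l q k, q \in S l -> k \in S l -> color q = color k].

End Partitions.

(* Main.v *)
(** States, inputs and outputs are carried to column indices by bijections
    [code] with [vec_of x = delta (code x)]; through them the edges of the
    graphs are the transitions of the network and two vertices have the same
    colour iff the outputs agree. The fibres of [first_coords] after [T] form
    the partition in one direction. Conversely, a partition is the family of
    fibres of a map [g] from states to [boolvec s] whose fibres have the same
    cardinals as those of [first_coords], so matching the fibres one by one
    yields a bijection [T] with [first_coords (T x) = g x]. *)
Require Import Defs.
From mathcomp Require Import all_boot all_order all_algebra.
From mathcomp Require Import reals.

Local Open Scope ring_scope.

Lemma delta_inj (R : realType) (k : nat) : injective (@delta R k).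
Proof.
move=> i j /matrixP /(_ i ord0); rewrite !mxE eqxx.
by case: eqP => // _ /eqP; rewrite GRing.oner_eq0.
Qed.

Lemma mulmx_delta (R : realType) (a b : nat) (M : 'M[R]_(a, b)) (j : 'I_b) :
  M *m delta R j = col j M.
Proof. by rewrite /delta !colE mul1mx. Qed.

Lemma tens_delta (R : realType) (a b : nat) (i : 'I_a) (j : 'I_b) :
  delta R i *t delta R j = delta R (mxtens_index (i, j)).
Proof.
apply/matrixP => k c; rewrite !mxE.
case: (mxtens_indexP k) => k1 k2; rewrite mxtens_indexK /=.
rewrite (can_eq (@mxtens_indexK a b)) xpair_eqE.
by case: (k1 == i); case: (k2 == j); rewrite ?GRing.mulr1 ?GRing.mulr0.
Qed.

Lemma castmx_delta (R : realType) (k l : nat) (e : k = l) (i : 'I_k) :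
  castmx (e, muln1 1) (delta R i) = delta R (cast_ord e i).
Proof.
apply/matrixP => a b.
by rewrite castmxE !mxE -(inj_eq (@cast_ord_inj _ _ e)) cast_ordKV.
Qed.

(** Injectivity suffices, as both sides have [2 ^ k] elements. It follows by induction: the leading
    bit and the code of the remaining bits form the Kronecker index. *)
Lemma vec_of_code (R : realType) (k : nat) :
  exists2 code : boolvec k -> 'I_(2 ^ k),
    bijective code & forall x, vec_of R x = delta R (code x).
Proof.
suff [code ci cE] : exists2 code : boolvec k -> 'I_(2 ^ k),
    injective code & forall x, vec_of R x = delta R (code x).
  exists code => //; apply: inj_card_bij => //.
  by rewrite card_ord card_ffun card_bool card_ord.
elim: k => [|k [code ci cE]].
  exists (fun=> ord0) => [x y _|x]; first by apply/ffunP; case.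
  by apply/matrixP => i j; rewrite !mxE !ord1.
pose bit (b : bool) : 'I_2 := if b then ord0 else ord_max.
pose tail (x : boolvec k.+1) : boolvec k := [ffun i => x (lift ord0 i)].
exists (fun x : boolvec k.+1 =>
          cast_ord (esym (expnS 2 k)) (mxtens_index (bit (x ord0), code (tail x)))).
  move=> x y /cast_ord_inj /(can_inj (@mxtens_indexK _ _)) [].
  move=> eq0 /ci /ffunP eqT; apply/ffunP => i.
  case: (unliftP ord0 i) => [j|] ->; first by have := eqT j; rewrite !ffunE.
  by move: eq0; rewrite /bit; case: (x ord0); case: (y ord0).
move=> x; rewrite -castmx_delta -tens_delta -cE /vec_of /=; congr castmx.
congr (_ *t _); first by rewrite /bool_vec /bit; case: (x ord0).
(* [kron] takes a plain function, so pointwise equality is carried through it by induction. *)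
have eq_kron (v w : 'I_k -> 'cV[R]_2) : v =1 w -> kron v = kron w.
  elim: (k) v w => [|k' IH] v w vw //=.
  by rewrite vw (IH _ (fun i => w (lift ord0 i))).
by apply: eq_kron => i; rewrite ffunE.
Qed.

(** Once the first [s] coordinates are fixed to [z], the other [n - s] are free: the fibre is the
    image of the injection [glue]. *)
Lemma card_fiber_first_coords {n s : nat} (hs : (s <= n)%N) (z : boolvec s) :
  #|[set x | first_coords hs x == z]| = (2 ^ (n - s))%N.
Proof.
have [r def_n] : exists r, n = (s + r)%N by exists (n - s)%N; rewrite subnKC.
subst n; rewrite addKn.
have lshiftE i : widen_ord hs i = lshift r i by apply: val_inj.
pose glue (w : boolvec r) : boolvec (s + r) :=
  [ffun i => match split i with inl j => z j | inr k => w k end].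
have glue_inj : injective glue.
  move=> v w /ffunP vw; apply/ffunP => k; have := vw (rshift s k).
  by rewrite !ffunE (unsplitK (inr _ k)).
suff -> : [set x | first_coords hs x == z] = glue @: setT.
  by rewrite card_imset // cardsT card_ffun card_bool card_ord.
apply/setP => x; rewrite inE; apply/eqP/imsetP => [xz|[w _ ->]].
  exists [ffun k => x (rshift s k)] => //; apply/ffunP => i.
  by rewrite ffunE; case: split_ordP => j ->; rewrite -?xz !ffunE ?lshiftE.
by apply/ffunP => j; rewrite !ffunE lshiftE (unsplitK (inl _ j)).
Qed.

Lemma card_bij_preim {X Y : finType} {f : X -> Y} (P : pred Y) :
  bijective f -> #|[set x | P (f x)]| = #|[set y | P y]|.
Proof.
move=> bijf; rewrite -(on_card_preimset (onW_bij _ bijf)).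
by apply: eq_card => x; rewrite !inE.
Qed.

(** [T] sends the element of rank [i] in a fibre of [g] to the element of rank [i] in the fibre of
    [f] over the same value. *)
Lemma fiberwise_bij {X Y : finType} (f g : X -> Y) :
  (forall y, #|[set x | f x == y]| = #|[set x | g x == y]|) ->
  exists2 T : X -> X, bijective T & forall x, f (T x) = g x.
Proof.
move=> eq_card.
pose E (h : X -> Y) x := enum [set x' | h x' == g x].
have ltE x : (index x (E g x) < size (E f x))%N.
  by rewrite -cardE eq_card cardE index_mem mem_enum inE.
pose T x := nth x (E f x) (index x (E g x)).
have fT x : f (T x) = g x.
  by apply/eqP; have := mem_nth x (ltE x); rewrite mem_enum inE.
exists T => //; apply: injF_bij => x y eqT.
have eqg : g x = g y by rewrite -!fT eqT.
(* [T x] and [T y] use different default values; the rank is in range, so the default may be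
   changed. *)
have ltE' := ltE y; move: eqT; rewrite /T (set_nth_default x y ltE').
have eqE h : E h y = E h x by rewrite /E eqg.
rewrite !eqE in ltE' *.
move/eqP; rewrite nth_uniq ?enum_uniq // => /eqP eqi.
rewrite -(nth_index x (s := E g x) (x := x)) ?mem_enum ?inE //.
by rewrite eqi nth_index // mem_enum inE eqg.
Qed.

Section Network.
Variables (n m p : nat) (B : bcn n m p).

(* [g] assigns to a state its block of an invariant, output-constant equal
   partition. *)
Definition compatible_quotient (s : nat) (g : boolvec n -> boolvec s) : Prop :=
  [/\ forall z, #|[set x | g x == z]| = (2 ^ (n - s))%N,
      forall x y u, g x = g y -> g (bcn_next B x u) = g (bcn_next B y u)
    & forall x y, g x = g y -> bcn_output B x = bcn_output B y].

(** Removes the coordinates: [g] plays the role of the first [s] coordinates of [T x]. *)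
Lemma decomposable_quotient (s : nat) : (s <= n)%N ->
  decomposable_wrt_outputs B (n - s) <->
  exists g : boolvec n -> boolvec s, compatible_quotient s g.
Proof.
move=> le_s_n; split.
  move=> [s' [hs [eq_s [T [f1 [f2 [h1 [bijT f1E _ h1E]]]]]]]].
  (* The order determines the number of leading coordinates, since both are at most [n]. *)
  have def_s : s' = s by rewrite -(subKn hs) -eq_s subKn.
  subst s'; exists (fun x => first_coords hs (T x)); split.
  - move=> z; rewrite -(card_fiber_first_coords hs z).
    exact: (card_bij_preim (fun x => first_coords hs x == z)).
  - by move=> x y u exy; apply/ffunP => i; rewrite !(ffunE, f1E) exy.
  - by move=> x y exy; apply/ffunP => i; rewrite !h1E exy.
move=> [g [card_g g_next g_out]].
have [|T bijT TE] := fiberwise_bij (first_coords le_s_n) g.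
  by move=> z; rewrite card_g card_fiber_first_coords.
have [T' TK _] := bijT.
(* The fibres of [g] are nonempty, so each has a representative; invariance makes the reduced
   dynamics and outputs independent of its choice. *)
have rep_ex z : exists x, g x == z.
  suff : (0 < #|[set x | g x == z]|)%N.
    by case/card_gt0P => x; rewrite inE; exists x.
  by rewrite card_g expn_gt0.
pose rep z := xchoose (rep_ex z).
have repK z : g (rep z) = z by apply/eqP/(xchooseP (rep_ex z)).
exists s, le_s_n; split=> //; exists T.
exists (fun i z u => g (bcn_next B (rep z) u) i).
exists (fun i z u => T (bcn_next B (T' z) u) i).
exists (fun i z => bcn_output B (rep z) i).
split=> // [x u i|x u i _|x i].
- rewrite TE (g_next _ x) ?repK // -TE [in RHS]ffunE //.
- by rewrite TK.
- by rewrite TE (g_out _ x) ?repK.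
Qed.

End Network.

Theorem theorem2 (R : realType) (n m p : nat) (B : bcn n m p)
  (L : 'M[R]_(2 ^ n, 2 ^ m * 2 ^ n)) (H : 'M[R]_(2 ^ p, 2 ^ n))
  (L_logical : forall j : 'I_(2 ^ m), logical_mx (input_block L j))
  (H_logical : logical_mx H)
  (LH_form : algebraic_form B L H)
  (s : nat) (le_s_n : (s <= n)%N)
  (C : Type) (color : 'I_(2 ^ n) -> C)
  (colorP : forall mu lambda : 'I_(2 ^ n),
     color mu = color lambda <-> H *m delta R mu = H *m delta R lambda) :
  decomposable_wrt_outputs B (n - s)
  <->
  exists S : 'I_(2 ^ s) -> {set 'I_(2 ^ n)},
    cc_pevp (fun j : 'I_(2 ^ m) => induced_graph (input_block L j)) color S /\
    (forall l, #|S l| = (2 ^ (n - s))%N).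
Proof.
have [cn [dn cnK dnK] cnE] := vec_of_code R n.
have [cm [dm cmK dmK] cmE] := vec_of_code R m.
have [cp [dp cpK dpK] cpE] := vec_of_code R p.
have [cs [ds csK dsK] _] := vec_of_code R s.
have [formL formH] := LH_form.
(* Each vertex has exactly one out-neighbour in each graph: the code of the next state. *)
have edgeE u x k :
    induced_graph (input_block L (cm u)) (cn x) k = (k == cn (bcn_next B x u)).
  have := formL x u; rewrite !cnE cmE tens_delta mulmx_delta.
  move=> /matrixP /(_ k ord0); rewrite !mxE /induced_graph mxE => <-.
  by case: (k == _); rewrite ?GRing.oner_eq0 ?eqxx.
have colorE x y :
    color (cn x) = color (cn y) <-> bcn_output B x = bcn_output B y.
  rewrite colorP -!cnE -!formH !cpE; split=> [/delta_inj /(can_inj cpK)|->] //.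
rewrite (decomposable_quotient _ _ _ _ _ le_s_n).
split=> [[g [card_g g_next g_out]]|[S [[[[covS disjS] _] stepS colS] cardS]]].
  pose S l := [set q | g (dn q) == ds l].
  have cardS l : #|S l| = (2 ^ (n - s))%N.
    rewrite -(card_g (ds l)); apply: (card_bij_preim (fun x => g x == ds l)).
    by exists cn.
  exists S; split=> //; split.
  - split; last first.
      move=> l; rewrite cardS card_ord -{2}(subnK le_s_n) expnD GRing.natrM.
      by rewrite GRing.mulfK // Num.Theory.pnatr_eq0 expn_eq0.
    split=> [|i j neq_ij].
      apply/setP => q; rewrite inE; apply/bigcupP.
      by exists (cs (g (dn q))) => //; rewrite inE csK.
    apply/setP => q; rewrite !inE; apply/negP => /andP [/eqP-> /eqP].
    by move/(can_inj dsK)/eqP; apply/negP.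
  (* The block is nonempty, and the successor of any member [q0] determines the target block. *)
  - move=> l j; have /card_gt0P [q0] : (0 < #|S l|)%N by rewrite cardS expn_gt0.
    rewrite inE => /eqP q0l.
    exists (cs (g (bcn_next B (dn q0) (dm j)))); apply/subsetP => k.
    rewrite inE => /existsP [q /andP []]; rewrite inE => /eqP ql.
    rewrite -(dnK q) -(dmK j) edgeE => /eqP ->; rewrite inE cnK csK !dmK.
    by apply/eqP/g_next; rewrite ql q0l.
  - move=> l q k; rewrite !inE => /eqP ql /eqP kl.
    by rewrite -(dnK q) -(dnK k); apply/colorE/g_out; rewrite ql kl.
have block_ex q : exists l, q \in S l.
  by have := in_setT q; rewrite -covS => /bigcupP [l _ ql]; exists l.
pose block q := xchoose (block_ex q).
(* Covering gave a block containing [q]; disjointness makes it unique. *)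
have blockE q l : (q \in S l) = (block q == l).
  have qb : q \in S (block q) := xchooseP (block_ex q).
  apply/idP/eqP => [ql|<- //]; apply/eqP/negPn/negP => /disjS /setP /(_ q).
  by rewrite !inE qb ql.
exists (fun x => ds (block (cn x))); split.
- move=> z; rewrite -(cardS (cs z)).
  rewrite (card_bij_preim (fun q => ds (block q) == z)); last by exists dn.
  by apply: eq_card => q; rewrite !inE blockE -(can_eq dsK) csK.
- move=> x y u /(can_inj dsK) exy; congr ds.
  have [a /subsetP sub_a] := stepS (block (cn x)) (cm u).
  suff blockN w : block (cn w) = block (cn x) ->
      block (cn (bcn_next B w u)) = a by rewrite !blockN.
  move=> ew; apply/eqP; rewrite -blockE; apply: sub_a; rewrite inE.
  by apply/existsP; exists (cn w); rewrite blockE ew eqxx edgeE eqxx.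
- move=> x y /(can_inj dsK) exy; apply/colorE.
  by apply: (colS (block (cn x))); rewrite blockE ?exy.
Qed.
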